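(* For all integers $k> d \geq 2$ and every positive integer $n$, we have $$ex_{b,c}(n,n,S_{2k+1,d*1}) \leq 2nk + 1.$$
   Context: Graphs are finite and simple. For integers $a,b$ and a graph $H$, $ex_{b,c}(a,b,H)$ denotes the maximum number of edges in a connected bipartite graph with part sizes $a$ and $b$ that does not contain $H$ as a (not necessarily induced) subgraph. The broom $S_{p,d*1}$ is the tree composed of a path on $p$ vertices and a star with $d$ branches centered at one end of the path: that is, take a path $x_1x_2\cdots x_p$ on $p$ vertices and add $d$ new vertices, each adjacent only to $x_1$. It has $p+d$ vertices and $d+1$ leaves (for $p\geq 2$). *)

(* Defs.v *)
From mathcomp Require Import all_boot.

Set Implicit Arguments.
Unset Strict Implicit.
Unset Printing Implicit Defensive.

(* A graph on the vertex type T is given by its set of edges, each edge being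
   an unordered pair of distinct vertices. *)
Definition simple_graph (T : finType) (G : {set {set T}}) : bool :=
  [forall e in G, #|e| == 2].

Definition adjacent (T : finType) (G : {set {set T}}) : rel T :=
  [rel x y | [set x; y] \in G].

Definition connected_graph (T : finType) (G : {set {set T}}) : bool :=
  [forall x, forall y, connect (adjacent G) x y].

(* The parts are A and its complement; an edge of a simple graph has exactly
   one endpoint in each part iff it meets A in one vertex. *)
Definition bipartite_with_parts (T : finType) (a b : nat)
    (G : {set {set T}}) : bool :=
  [exists A : {set T},
    [&& #|A| == a, #|~: A| == b & [forall e in G, #|e :&: A| == 1]]].

Definition contains_subgraph (S T : finType) (H : {set {set S}})
    (G : {set {set T}}) : bool :=
  [exists f : {ffun S -> T},
    injectiveb f && [forall e in H, f @: e \in G]].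

(* Since every graph with parts of sizes a and b has a + b vertices, it is
   enough, up to isomorphism, to range over the graphs on 'I_(a + b). The
   maximum of an empty family is 0. *)
Definition ex_bc (a b : nat) (S : finType) (H : {set {set S}}) : nat :=
  \max_(G : {set {set 'I_(a + b)}} |
      [&& simple_graph G, bipartite_with_parts a b G, connected_graph G
        & ~~ contains_subgraph H G]) #|G|.

(* inl i is the path vertex x_(i+1) and the inr j are the d added leaves, all
   attached to inl 0 = x_1 (p is meant to be positive). *)
Definition broom (p d : nat) : {set {set 'I_p + 'I_d}} :=
  [set e | [exists i : 'I_p, exists j : 'I_p,
              (j == i.+1 :> nat) && (e == [set inl i; inl j])]
        || [exists i : 'I_p, exists j : 'I_d,
              (i == 0 :> nat) && (e == [set inl i; inr j])]].

(* Main.v *)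
Require Import Defs.
From mathcomp Require Import all_boot.

(** Let [G] be a bipartite graph on [N] vertices with more than [k * N] edges;
    the claim is that it contains every broom made of a path on [2 * k + 1]
    vertices and [d <= k] leaves.  For [N = 2 * n] this bounds the number of
    edges of a broom-free graph by [2 * n * k].

    Let [U] be a smallest vertex set spanning more than [k * #|U|] edges.
    Removing a vertex of degree at most [k] from [U] would leave a smaller such
    set, so every vertex of [U] has at least [k + 1] neighbours in [U]
    ([min_degree_of_minimal]).  Moreover the average degree in [U] exceeds
    [2 * k], so some vertex [v] of [U] has more than [2 * k] neighbours in [U]
    ([exists_large_degree]).

    A path from [v] with at most [2 * k + 1] vertices can be prolonged inside
    [U]: colours alternate along it, so at most [k] of its vertices are
    neighbours of its last vertex, which has at least [k + 1] neighbours
    ([card_nbrs_on_path], [exists_long_path]).  Once the path has [2 * k + 1]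
    vertices, at most [k] of them are neighbours of [v], so more than [k]
    neighbours of [v] lie off the path and can serve as leaves. *)

Set Implicit Arguments.
Unset Strict Implicit.
Unset Printing Implicit Defensive.

(** * Alternating colours and embedded brooms *)

Lemma adjacent_sym (T : finType) (G : {set {set T}}) : symmetric (adjacent G).
Proof. by move=> x y; rewrite /adjacent /= setUC. Qed.

(** Colours alternate along a path, so the vertices coloured unlike the first
    one are those at odd positions. *)
Lemma count_other_colour (T : Type) (e : rel T) (c : T -> bool) (x : T) p :
    (forall y z, e y z -> c y != c z) -> path e x p ->
  count (fun y => c y != c x) (x :: p) = uphalf (size p).
Proof.
move=> proper_c; elim: p x => [|y p IHp] x /=; first by rewrite eqxx.
case/andP=> /proper_c cxy /IHp {IHp}count_y; rewrite eqxx add0n.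
have flip z : (c z != c x) = predC (fun z => c z != c y) z.
  by move: cxy => /=; case: (c x); case: (c y); case: (c z).
rewrite -[LHS]/(count (fun z => c z != c x) (y :: p)) (eq_count flip).
apply: (@addnI (uphalf (size p))).
rewrite -{1}count_y count_predC /= addnS uphalf_half -addnA addnn.
by rewrite odd_double_half.
Qed.

(** The path vertex [x_1] of the broom is sent to the start [x] of the path and
    the added leaves to vertices of [L]. *)
Lemma contains_broom (T : finType) (G : {set {set T}}) (x : T) q (L : {set T}) d :
    path (adjacent G) x q -> uniq (x :: q) -> d <= #|L| ->
    {in L, forall y, adjacent G x y /\ y \notin x :: q} ->
  contains_subgraph (broom (size q).+1 d) G.
Proof.
move=> /(pathP x) path_q uniq_q dL adjL.
have ltL (j : 'I_d) : j < size (enum L).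
  by rewrite -cardE (leq_trans (ltn_ord j)).
have inL (j : 'I_d) : nth x (enum L) j \in L by rewrite -mem_enum mem_nth.
pose f (s : 'I_(size q).+1 + 'I_d) :=
  match s with inl i => nth x (x :: q) i | inr j => nth x (enum L) j end.
apply/existsP; exists (finfun f); apply/andP; split.
  apply/injectiveP => s t; rewrite !ffunE.
  case: s t => [i|j] [i'|j'] /= eq_f.
  - congr inl; apply/val_inj/eqP.
    by rewrite -(nth_uniq x (s := x :: q)) ?ltn_ord //; apply/eqP.
  - by have [_ /negP[]] := adjL _ (inL j'); rewrite -eq_f mem_nth /=.
  - by have [_ /negP[]] := adjL _ (inL j); rewrite eq_f mem_nth /=.
  - congr inr; apply/val_inj/eqP.
    by rewrite -(nth_uniq x (ltL j) (ltL j')) ?enum_uniq //; apply/eqP.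
apply/forall_inP => E; rewrite inE => /orP[] /existsP[i /existsP[j]].
  case/andP=> /eqP ji /eqP->; rewrite imsetU1 imset_set1 !ffunE /= ji /=.
  by apply: path_q; rewrite -ltnS -ji ltn_ord.
case/andP=> /eqP i0 /eqP->; rewrite imsetU1 imset_set1 !ffunE /= i0 /=.
by have [] := adjL _ (inL j).
Qed.

(** * Edges spanned by a vertex set *)

Definition span_edges (T : finType) (G : {set {set T}}) (U : {set T}) :=
  [set e in G | e \subset U].

Definition nbrs (T : finType) (G : {set {set T}}) (U : {set T}) (v : T) :=
  [set w in U | adjacent G v w].

Lemma in_nbrs (T : finType) (G : {set {set T}}) (U : {set T}) v w :
  (w \in nbrs G U v) = (w \in U) && adjacent G v w.
Proof. by rewrite inE. Qed.

Lemma card_incident_le (T : finType) (G : {set {set T}}) (U : {set T}) (v : T) :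
  simple_graph G -> #|[set e in span_edges G U | v \in e]| <= #|nbrs G U v|.
Proof.
move/forall_inP=> simpleG.
apply: leq_trans (leq_imset_card (fun w => [set v; w]) _).
apply/subset_leq_card/subsetP => e; rewrite !inE -andbA => /and3P[eG eU ve].
have /cards2P[a [b [_ def_e]]] := simpleG e eG; subst e.
have [w def_e] : exists w, [set a; b] = [set v; w].
  move: ve; rewrite !inE => /orP[] /eqP ->; first by exists b.
  by exists a; rewrite setUC.
apply/imsetP; exists w => //; rewrite inE /adjacent /= -def_e eG andbT.
by apply: (subsetP eU); rewrite def_e !inE eqxx orbT.
Qed.

(** Deleting [v] from [U] lowers [k * #|U|] by [k] and loses only the edges at
    [v]; if these were at most [k], then [U :\ v] would contradict minimality. *)
Lemma min_degree_of_minimal (T : finType) (G : {set {set T}}) k (U : {set T}) v :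
    simple_graph G -> k * #|U| < #|span_edges G U| ->
    (forall W : {set T}, k * #|W| < #|span_edges G W| -> #|U| <= #|W|) ->
  v \in U -> k < #|nbrs G U v|.
Proof.
move=> simpleG denseU minU vU; rewrite ltnNge; apply/negP => deg_v.
suff /minU : k * #|U :\ v| < #|span_edges G (U :\ v)|.
  by rewrite (cardsD1 v U) vU ltnn.
have sub_edges : span_edges G U \subset
    span_edges G (U :\ v) :|: [set e in span_edges G U | v \in e].
  apply/subsetP => e; rewrite !inE subsetD1 => /andP[-> ->] /=.
  by rewrite orNb.
rewrite -(ltn_add2r k) -mulnSr.
have -> : #|U :\ v|.+1 = #|U| by rewrite (cardsD1 v U) vU.
apply: leq_trans denseU (leq_trans (subset_leq_card sub_edges) _).
apply: leq_trans (leq_card_setU _ _) _.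
by rewrite leq_add2l (leq_trans (card_incident_le U v simpleG)).
Qed.

(** If every degree in [U] were at most [2 * k], the degree sum, twice the
    number of spanned edges, would be at most [2 * k * #|U|]. *)
Lemma exists_large_degree (T : finType) (G : {set {set T}}) k (U : {set T}) :
    simple_graph G -> k * #|U| < #|span_edges G U| ->
  exists2 v, v \in U & k.*2 < #|nbrs G U v|.
Proof.
move=> simpleG denseU; apply/exists_inP; apply: contraT.
rewrite negb_exists_in => /forall_inP small.
have degree_sum :
    \sum_(v in U) #|[set e in span_edges G U | v \in e]| = #|span_edges G U|.*2.
  under eq_bigr => v _ do rewrite -sum1_card.
  rewrite (exchange_big_dep (mem (span_edges G U))) /=; last first.
    by move=> v e _; rewrite inE => /andP[].
  rewrite -muln2 -sum_nat_const; apply: eq_bigr => e eGU.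
  have := eGU; rewrite inE => /andP[eG eU].
  rewrite -(eqP (forall_inP simpleG e eG)) -sum1_card; apply: eq_bigl => v.
  rewrite inE eGU /=.
  by case: (boolP (v \in e)) => [/(subsetP eU) ->|]; rewrite ?andbF.
have : \sum_(v in U) #|[set e in span_edges G U | v \in e]| <= #|U| * k.*2.
  rewrite -sum_nat_const; apply: leq_sum => v vU.
  by rewrite (leq_trans (card_incident_le U v simpleG)) // leqNgt small.
by rewrite degree_sum -doubleMr leq_double mulnC leqNgt denseU.
Qed.

(** * Finding the broom *)

(** Neighbours of [x] on the path are coloured unlike [x], which holds for only
    about half of the path. *)
Lemma card_nbrs_on_path (T : finType) (G : {set {set T}}) (c : T -> bool) U x p :
    (forall y z, adjacent G y z -> c y != c z) -> path (adjacent G) x p ->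
  #|nbrs G U x :&: [set y in x :: p]| <= uphalf (size p).
Proof.
move=> proper_c path_p; rewrite -(count_other_colour proper_c path_p).
rewrite -size_filter; apply: leq_trans (card_size _).
apply/subset_leq_card/subsetP => y; rewrite in_setI [y \in [set _ in _]]inE.
rewrite in_nbrs mem_filter => /andP[/andP[_ xy] ->]; rewrite andbT eq_sym.
exact: proper_c.
Qed.

Lemma exists_long_path (T : finType) (G : {set {set T}}) (c : T -> bool)
    (U : {set T}) k v m :
    (forall y z, adjacent G y z -> c y != c z) ->
    {in U, forall w, k < #|nbrs G U w|} -> v \in U -> m <= k.*2.+1 ->
  exists q, [/\ path (adjacent G) v q, uniq (v :: q) & size q = m].
Proof.
move=> proper_c min_deg vU le_m.
(* The path is grown at its head, so that the colour count applies to the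
   vertex to be left, and is turned round at the end. *)
have [w [p [_ path_p uniq_p last_p size_p]]] : exists w p, [/\ w \in U,
    path (adjacent G) w p, uniq (w :: p), last w p = v & size p = m].
  elim: m le_m => [|m IHm] le_m; first by exists v, [::].
  have [w [p [wU path_p uniq_p last_p size_p]]] := IHm (ltnW le_m).
  have : 0 < #|nbrs G U w :\: [set y in w :: p]|.
    rewrite cardsD subn_gt0.
    apply: leq_ltn_trans (card_nbrs_on_path U proper_c path_p) _.
    apply: leq_ltn_trans (min_deg w wU).
    by rewrite size_p leq_uphalf_double.
  case/card_gt0P=> u; rewrite in_setD [u \in [set _ in _]]inE in_nbrs.
  case/and3P=> up uU wu.
  exists u, (w :: p); split => //=; last by rewrite size_p.
    by rewrite path_p andbT -/(is_true (adjacent G u w)) adjacent_sym.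
  by rewrite up.
exists (rev (belast w p)); split.
- rewrite -last_p rev_path; apply: sub_path path_p => y z.
  by rewrite adjacent_sym.
- by rewrite -last_p -rev_rcons -lastI rev_uniq.
- by rewrite size_rev size_belast.
Qed.

Theorem card_edges_no_broom (T : finType) (G : {set {set T}}) (c : T -> bool) k d :
    simple_graph G -> (forall x y, adjacent G x y -> c x != c y) -> d <= k ->
    ~~ contains_subgraph (broom k.*2.+1 d) G ->
  #|G| <= k * #|T|.
Proof.
move=> simpleG proper_c le_dk; apply: contraR; rewrite -ltnNge => denseG.
pose dense (U : {set T}) := k * #|U| < #|span_edges G U|.
have denseT : dense setT.
  rewrite /dense cardsT; apply: leq_trans denseG (subset_leq_card _).
  by apply/subsetP => e eG; rewrite inE eG subsetT.
case: (arg_minnP (fun U : {set T} => #|U|) denseT) => U denseU minU.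
have [v vU deg_v] := exists_large_degree simpleG denseU.
have min_deg : {in U, forall w, k < #|nbrs G U w|}.
  by move=> w; apply: min_degree_of_minimal.
have [q [path_q uniq_q size_q]] :=
  exists_long_path proper_c min_deg vU (leqnSn k.*2).
rewrite -size_q.
apply: (contains_broom (L := nbrs G U v :\: [set y in v :: q]) path_q) => //.
  have le_on := card_nbrs_on_path U proper_c path_q.
  rewrite size_q uphalf_double in le_on.
  apply: leq_trans le_dk _; rewrite cardsD leq_subRL; last first.
    exact: subset_leq_card (subsetIl _ _).
  by apply: leq_trans (ltnW deg_v); rewrite -addnn leq_add2r.
move=> y; rewrite in_setD [y \in [set _ in _]]inE in_nbrs.
by case/and3P=> yq _ vy.
Qed.

Lemma bipartite_adjacent (T : finType) (G : {set {set T}}) (A : {set T}) x y :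
    simple_graph G -> (forall e, e \in G -> #|e :&: A| = 1) ->
  adjacent G x y -> (x \in A) != (y \in A).
Proof.
move=> simpleG bipG xy; have := bipG _ xy.
have card_xy := eqP (forall_inP simpleG _ xy).
case xA: (x \in A); case yA: (y \in A) => // cardI.
  have sub : [set x; y] \subset A by rewrite subUset !sub1set xA yA.
  by move: cardI; rewrite (setIidPl sub) card_xy.
have disj : [set x; y] :&: A = set0.
  apply/setP => z; rewrite !inE.
  by case: eqP => [->|_]; [rewrite xA andbF|case: eqP => [->|//]; rewrite yA].
by move: cardI; rewrite disj cards0.
Qed.

Theorem theorem1p7 (k d n : nat) (hd : 2 <= d) (hk : d < k) (hn : 0 < n) :
  ex_bc n n (broom (2 * k + 1) d) <= 2 * n * k + 1.
Proof.
rewrite addn1; apply/bigmax_leqP => G.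
case/and4P=> simpleG /existsP[A /and3P[_ _ /forall_inP bipG]] _ no_broom.
have -> : 2 * n * k + 1 = (k * #|'I_(n + n)|).+1.
  by rewrite card_ord addnn mul2n mulnC addn1.
rewrite mul2n in no_broom.
apply/leqW/(card_edges_no_broom (c := mem A) (d := d)) => //; last exact: ltnW.
by move=> x y; apply: bipartite_adjacent simpleG _ => e /bipG/eqP.
Qed.
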